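(* Let $Q_t$ be a sub-Markov semigroup on $D^*$ and let $\Gamma(x^*,x)$ be a bounded nonnegative measurable function on $D^*\times D$. Suppose that $Q_t$ is a Liggett dual of $P_t$ with respect to $\Gamma$, and that $$h(x^* )=\int\Gamma(x^*,x)\nu(x)\,dx$$ is finite and strictly positive on $D^*$. Then the Markov semigroup $$Q^*_tf(x^* )=\frac{1}{h(x^* )}Q_t[hf](x^* )$$ is an intertwining dual of $P_t$ with respect to the link $$\lambda(x^*,x)=\frac{\Gamma(x^*,x)}{h(x^* )}\nu(x).$$
   Context: Let $D=\mathbb{R}^n$ and let $D^*$ be a Polish space. Let $\gamma:\mathbb{R}^n\to\mathbb{R}$, $\nu=\exp(-2\gamma)$, $\beta=\nabla\gamma$ (assumed smooth enough), and let $P_t$ be the Markov semigroup on $D$ of the characteristic diffusion for $\nu$: the diffusion $dX(t)=-\beta(X(t))dt+dW(t)$ with generator $\mathcal{A}f=\sum_{i=1}^n[\frac12\partial_i^2f-\beta_i\partial_if]$. It has a positive conservative transition density $p(t,x,y)$, so $P_t(x,dy)=p(t,x,y)dy$, which is $\nu$-symmetric: $\nu(x)p(t,x,y)=\nu(y)p(t,y,x)$. $Q_t$ is a Liggett dual of $P_t$ with respect to $\Gamma$ if $\int P_t(x,dy)\Gamma(x^*,y)=\int Q_t(x^*,dy^* )\Gamma(y^*,x)$ for all $(x^*,x)\in D^*\times D$. A link is a Markov kernel density $\lambda$ from $D^*$ to $D$ ($\lambda(x^*,\cdot)$ is a probability density for each $x^*$), and $\Lambda[f](x^* )=\int\lambda(x^*,x)f(x)\,dx$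 for bounded measurable $f$ on $D$. A Markov semigroup $Q^*_t$ on $D^*$ is an intertwining dual of $P_t$ with respect to the link $\lambda$ (or $\Lambda$) if $\Lambda[P_tf]=Q^*_t[\Lambda f]$ for all bounded measurable $f$ on $D$ and all $t$. *)

(* Defs.v *)
From HB Require Import structures.
From mathcomp Require Import all_boot all_order all_algebra.
From mathcomp Require Import all_classical all_reals all_analysis.

Set Implicit Arguments.
Unset Strict Implicit.
Unset Printing Implicit Defensive.

Import Order.TTheory GRing.Theory Num.Theory.
Import numFieldNormedType.Exports.

Local Open Scope classical_set_scope.
Local Open Scope ring_scope.

(* A topological space seen as a measurable space, with its Borel sigma-algebra. *)
Notation borel T := (g_sigma_algebraType (@open T)).

(* Image of a sigma-finite measure by a bimeasurable bijection; the inverse [g]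
   only serves to keep sigma-finiteness. *)
Section image_measure.
Context d d' (T : measurableType d) (U : measurableType d') (R : realType).
Variable mu : {measure set T -> \bar R}.
Variables (f : T -> U) (g : U -> T).
Hypotheses (mu_sf : sigma_finite setT mu).
Hypotheses (mf : measurable_fun setT f) (mg : measurable_fun setT g).
Hypothesis fK : cancel f g.

Lemma pushforward_semi_sigma_additive : semi_sigma_additive (pushforward mu f).
Proof.
move=> F mF tF mUF; rewrite /pushforward preimage_bigcup.
apply: measure_semi_sigma_additive.
- by move=> n; rewrite -[X in measurable X]setTI; exact: mf.
- apply/trivIsetP => /= i j _ _ ij; rewrite -preimage_setI.
  by move/trivIsetP : tF => /(_ _ _ _ _ ij) ->//; rewrite preimage_set0.
- by rewrite -preimage_bigcup -[X in measurable X]setTI; exact: mf.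
Qed.

Lemma pushforward_sigma_finite : sigma_finite setT (pushforward mu f).
Proof.
have [F TF Foo] := mu_sf.
exists (fun n => g @^-1` F n) => [|n].
  by rewrite -preimage_bigcup -TF preimage_setT.
have [mF Fn] := Foo n; split.
  by rewrite -[X in measurable X]setTI; exact: mg.
suff -> : pushforward mu f (g @^-1` F n) = mu (F n) by [].
by congr (mu _); apply/funext => x /=; rewrite /preimage/= fK.
Qed.

Let im (A : set U) : \bar R := mu (f @^-1` A).

Let im0 : im set0 = 0%E. Proof. by rewrite /im preimage_set0 measure0. Qed.

Let im_ge0 A : (0 <= im A)%E. Proof. exact: measure_ge0. Qed.

Definition image_measure : {sigma_finite_measure set U -> \bar R} :=
  let m := isMeasure.Build _ _ _ im
    im0 im_ge0 pushforward_semi_sigma_additive in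
  let M : {measure set U -> \bar R} := HB.pack im m in
  let sf := isSFinite.Build _ _ _ im
    (@sfinite_measure_sigma_finite _ _ _ M pushforward_sigma_finite) in
  let sgf := isSigmaFinite.Build _ _ _ im pushforward_sigma_finite in
  HB.pack im m sf sgf.

End image_measure.

(* Lebesgue measure on R^n: the n-fold product of the Lebesgue measure of R on
   n.-tuple R, carried to the Borel sigma-algebra of 'rV[R]_n. *)
Section lebesgue_tuple.
Context (R : realType).

Definition tcons n (xt : R * n.-tuple R) : n.+1.-tuple R :=
  [tuple of xt.1 :: xt.2].

Definition tuncons n (t : n.+1.-tuple R) : R * n.-tuple R :=
  (thead t, [tuple of behead t]).

Lemma tconsK n : cancel (@tcons n) (@tuncons n).
Proof. by move=> [x t]; rewrite /tuncons theadE; congr pair; exact/val_inj. Qed.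

Lemma tunconsK n : cancel (@tuncons n) (@tcons n).
Proof. by move=> t; rewrite /tcons [RHS]tuple_eta. Qed.

Lemma measurable_tcons n :
  measurable_fun [set: (measurableTypeR R * n.-tuple (measurableTypeR R))%type]
    (@tcons n : _ -> n.+1.-tuple (measurableTypeR R)).
Proof. exact: measurable_cons. Qed.

Lemma measurable_tuncons n :
  measurable_fun [set: n.+1.-tuple (measurableTypeR R)]
    (@tuncons n : _ -> measurableTypeR R * n.-tuple (measurableTypeR R)).
Proof.
apply/measurable_fun_pairP.
by split; [exact: measurable_tnth|exact: measurable_behead].
Qed.

Lemma sigma_finite_product d1 d2 (T1 : measurableType d1) (T2 : measurableType d2)
    (m1 : {sigma_finite_measure set T1 -> \bar R})
    (m2 : {sigma_finite_measure set T2 -> \bar R}) :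
  sigma_finite setT (m1 \x m2)%E.
Proof.
have /sigma_finiteP[F [TF ndF Foo]] := sigma_finiteT m1.
have /sigma_finiteP[G [TG ndG Goo]] := sigma_finiteT m2.
exists (fun n => F n `*` G n).
  rewrite -setXTT TF TG predeqE => -[x y]; split.
    move=> [/= [n _ Fnx] [k _ Gky]]; exists (maxn n k) => //; split.
    - by move: x Fnx; exact/subsetPset/ndF/leq_maxl.
    - by move: y Gky; exact/subsetPset/ndG/leq_maxr.
  by move=> [n _ []/= ? ?]; split; exists n.
move=> k; have [? ?] := Foo k; have [? ?] := Goo k.
split; first exact: measurableX.
by rewrite product_measure1E// lte_mul_pinfty// ge0_fin_numE.
Qed.

Fixpoint lebesgue_tuple n :
    {sigma_finite_measure set (n.-tuple (measurableTypeR R)) -> \bar R} :=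
  match n with
  | 0 => dirac [tuple]
  | n'.+1 =>
      image_measure
       (sigma_finite_product lebesgue_measure (lebesgue_tuple n'))
       (@measurable_tcons n') (@measurable_tuncons n') (@tconsK n')
  end.

Definition row_tuple n (t : n.-tuple R) : 'rV[R]_n := \row_i tnth t i.
Definition tuple_row n (x : 'rV[R]_n) : n.-tuple R := [tuple x ord0 i | i < n].
Lemma row_tupleK n : cancel (@row_tuple n) (@tuple_row n).
Proof. by move=> t; apply: eq_from_tnth => i; rewrite tnth_mktuple mxE. Qed.

Lemma tuple_rowK n : cancel (@tuple_row n) (@row_tuple n).
Proof. by move=> x; apply/rowP => i; rewrite mxE tnth_mktuple. Qed.

Lemma measurable_row_tuple n :
  measurable_fun [set: n.-tuple (measurableTypeR R)]
    (@row_tuple n : n.-tuple (measurableTypeR R) -> borel 'rV[R]_n).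
Proof.
apply: (@measurability _ _ _ (borel 'rV[R]_n) _ _ (@open 'rV[R]_n)) => //.
move=> _ [U oU <-]; rewrite setTI.
pose q (z : 'rV[rat]_n * nat) : 'rV[R]_n := map_mx ratr z.1.
have -> : @row_tuple n @^-1` U = \bigcup_(z : 'rV[rat]_n * nat)
   ([set t | ball (q z) z.2.+1%:R^-1 (row_tuple t)] `&`
    [set _ | ball (q z) z.2.+1%:R^-1 `<=` U]).
  apply/seteqP; split => [t Ut|t [z _ [/= zt zU]]]; last exact: zU.
  have /nbhs_ballP[e /= e0 eU] : nbhs (row_tuple t) U by exact: open_nbhs_nbhs.
  have [k k0] : exists k : nat, (k.+1%:R^-1 : R) < e / 2.
    have /ltr_add_invr[k] : 0 < e / 2 by rewrite divr_gt0.
    by rewrite add0r => ?; exists k.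
  have k1 : 0 < k.+1%:R^-1 :> R by rewrite invr_gt0.
  have /choice[r rP] : forall i : 'I_n, exists r : rat,
      ball (tnth t i) k.+1%:R^-1 (ratr r : R).
    move=> i; have [] := @dense_rat R (ball (tnth t i) k.+1%:R^-1).
    - by exists (tnth t i); exact: ballxx.
    - exact: ball_open.
    - by move=> y [ty [r _ ry]]; exists r; rewrite ry.
  exists (\row_i r i, k) => //=; split => /=.
    split => // i j; rewrite ord1 !mxE; apply: ball_sym; exact: rP.
  move=> y [_ yP]; apply: eU; split => // i j; rewrite ord1 mxE.
  have tr : ball (tnth t j) (e / 2) (ratr (r j) : R).
    by apply: le_ball (rP j); exact: ltW.
  have ry : ball (ratr (r j) : R) (e / 2) (y ord0 j).
    by have := yP ord0 j; rewrite !mxE; apply: le_ball; exact: ltW.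
  by rewrite [e]splitr; exact: ball_triangle tr ry.
apply: countable_bigcupT_measurable => [|z]; first exact: countableP.
apply: measurableI; last first.
  by have [zU|zU] := pselect (ball (q z) z.2.+1%:R^-1 `<=` U);
   [rewrite (_ : mkset _ = setT)| rewrite (_ : mkset _ = set0)] => //;
   apply/seteqP; split.
rewrite (_ : mkset _ = \big[setI/setT]_(i < n)
   (@tnth n R ^~ i @^-1` (ball (q z ord0 i) z.2.+1%:R^-1))).
  apply: bigsetI_measurable => i _; rewrite -[X in measurable X]setTI.
  apply: measurable_tnth => //.
  by apply: measurable_realfun.open_measurable; exact: ball_open.
apply/seteqP; split => t /=.
  by move=> [_ H]; rewrite -bigcap_seq => i _ /=; have := H ord0 i; rewrite !mxE.
rewrite -bigcap_seq => H; split; first by rewrite invr_gt0.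
move=> i j; rewrite ord1; have := H j; rewrite /= mem_index_enum => /(_ isT).
by rewrite !mxE.
Qed.

Lemma measurable_tuple_row n :
  measurable_fun [set: borel 'rV[R]_n]
    (@tuple_row n : _ -> n.-tuple (measurableTypeR R)).
Proof.
apply/measurable_fun_tnthP => i.
move=> _ Y mY; rewrite setTI.
suff : measurable_fun [set: borel 'rV[R]_n]
    ((fun x : 'rV[R]_n => x ord0 i) : _ -> measurableTypeR R).
  move=> /(_ measurableT _ mY); rewrite setTI; congr (measurable _).
  by apply/seteqP; split => x /=; rewrite tnth_mktuple.
apply: (@measurability _ _ _ (measurableTypeR R) _ _
  (@measurable_realfun.RGenOpens.G R)).
  exact: measurable_realfun.RGenOpens.measurableE.
move=> _ [_ [a [b ->]] <-]; rewrite setTI; apply: sub_sigma_algebra.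
apply: open_comp; last exact: interval_open.
by move=> x _; exact: coord_continuous.
Qed.

Definition lebesgue_rV n :
    {sigma_finite_measure set (borel 'rV[R]_n) -> \bar R} :=
  image_measure (sigma_finiteT (lebesgue_tuple n)) (@measurable_row_tuple n)
    (@measurable_tuple_row n) (@row_tupleK n).

End lebesgue_tuple.

Section polish.
Variables (R : realType) (T : topologicalType).

(* [dist] is a complete metric inducing the topology of T *)
Definition complete_metric_for (dist : T -> T -> R) : Prop :=
  [/\ forall x y, 0 <= dist x y,
      forall x y, dist x y = 0 <-> x = y,
      forall x y, dist x y = dist y x &
      forall x y z, dist x z <= dist x y + dist y z] /\
  [/\ forall x (A : set T),
        nbhs x A <-> exists2 e : R, 0 < e & [set y | dist x y < e] `<=` A &
      forall u : nat -> T,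
        (forall e : R, 0 < e -> exists N : nat, forall i j : nat,
          (N <= i)%N -> (N <= j)%N -> dist (u i) (u j) < e) ->
        exists l : T, u @ \oo --> l].

Definition polish_space : Prop :=
  (exists dist, complete_metric_for dist) /\
  (exists2 S : set T, countable S & dense S).

End polish.

Section semigroups.
Context (R : realType) d (S : measurableType d).

Definition bounded_measurable d' (T : measurableType d') (f : T -> R) : Prop :=
  measurable_fun setT f /\ [bounded f x | x in setT].

Definition kernel_op d' (T : measurableType d')
    (K : R -> S -> {measure set T -> \bar R}) (t : R) (f : T -> R) (x : S) : R :=
  \int[K t x]_y f y.

(* Times range over t >= 0; the values at t < 0 are irrelevant. *)
Definition transition_semigroup (K : R -> S -> {measure set S -> \bar R}) : Prop :=
  (forall x A, measurable A -> K 0 x A = \d_x A) /\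
  (forall s t, 0 <= s -> 0 <= t -> forall x A, measurable A ->
    K (s + t) x A = (\int[K s x]_y K t y A)%E).

(* [T t] acts on bounded measurable functions through probability kernels that
   form a semigroup; its values on other functions are irrelevant. *)
Definition markov_semigroup (T : R -> (S -> R) -> S -> R) : Prop :=
  exists2 K : R -> R.-pker S ~> S,
    transition_semigroup (fun t => K t) &
    forall t, 0 <= t -> forall f, bounded_measurable f ->
      T t f =1 kernel_op (fun t => K t) t f.

End semigroups.

Section calculus.
Context (R : realType) (n : nat).
Implicit Types (f : 'rV[R]_n -> R) (x : 'rV[R]_n).

Definition pderiv (i : 'I_n) f x : R := 'D_(delta_mx ord0 i) f x.

Definition gradient f x : 'rV[R]_n := \row_i pderiv i f x.

Definition C1 f : Prop :=
  (forall x, differentiable f x) /\ (forall i, continuous (pderiv i f)).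

Definition C2c f : Prop :=
  [/\ C1 f, forall i, C1 (pderiv i f) & compact (closure [set x | f x != 0])].

(* sum_i [ (1/2) d_i^2 f - beta_i d_i f ] *)
Definition generator (beta : 'rV[R]_n -> 'rV[R]_n) f x : R :=
  \sum_(i < n) (2^-1 * pderiv i (pderiv i f) x - beta x ord0 i * pderiv i f x).

End calculus.

Section diffusion.
Context (R : realType) (n : nat).
Local Notation Rn := 'rV[R]_n.

Section on_a_probability_space.
Context d (Omega : measurableType d) (Pr : probability Omega R).
Variable F : R -> set (set Omega).

Definition filtration : Prop :=
  (forall t, 0 <= t -> sigma_algebra setT (F t) /\ F t `<=` measurable) /\
  (forall s t, 0 <= s -> s <= t -> F s `<=` F t).

Definition adapted (X : R -> Omega -> Rn) : Prop :=
  forall t, 0 <= t -> forall A : set (borel Rn), measurable A -> F t (X t @^-1` A).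

Definition continuous_paths (X : R -> Omega -> Rn) : Prop :=
  forall w, {within `[0, +oo[, continuous (fun t => X t w)}.

(* Standard n-dimensional F-Brownian motion: W_t - W_s is independent of F_s
   with law N(0, (t - s) I_n). *)
Definition brownian_motion (W : R -> Omega -> Rn) : Prop :=
  [/\ adapted W, continuous_paths W, forall w, W 0 w = 0 &
      forall s t, 0 <= s -> s < t ->
      forall (A : set Omega) (B : 'I_n -> set R),
        F s A -> (forall i, measurable (B i)) ->
        Pr (A `&` [set w | forall i, B i ((W t w - W s w) ord0 i)]) =
        (Pr A * (\prod_(i < n)
           fine (normal_prob 0 (Num.sqrt (t - s)) (B i)))%:E)%E].

(* dX(t) = - beta(X(t)) dt + dW(t), X(0) = x *)
Definition sde_solution (beta : Rn -> Rn) (x : Rn) (W X : R -> Omega -> Rn) :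
    Prop :=
  [/\ adapted X, continuous_paths X & forall t, 0 <= t -> forall w i,
      X t w ord0 i =
        x ord0 i - \int[lebesgue_measure]_(s in `[0, t]) (beta (X s w) ord0 i)
        + W t w ord0 i].

End on_a_probability_space.

Definition diffusion_law (beta : Rn -> Rn) (x : Rn)
    (mu : R -> {measure set (borel Rn) -> \bar R}) : Prop :=
  exists (d : measure_display) (Omega : measurableType d)
    (Pr : probability Omega R) (F : R -> set (set Omega))
    (W X : R -> Omega -> Rn),
    [/\ filtration F, brownian_motion Pr F W, sde_solution F beta x W X &
        forall t, 0 <= t -> forall A, measurable A ->
          mu t A = Pr (X t @^-1` A)].

Definition nu (gamma : Rn -> R) (x : Rn) : R := expR (- 2 * gamma x).

(* P is the Markov semigroup of the characteristic diffusion for nu gamma,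
   and p is its transition density. *)
Record characteristic_diffusion (gamma : Rn -> R)
    (P : R -> R.-pker (borel Rn) ~> (borel Rn)) (p : R -> Rn -> Rn -> R) : Prop := {
  cd_semigroup : transition_semigroup (fun t => P t);
  cd_sde : forall x, diffusion_law (gradient gamma) x (fun t => P t x);
  cd_generator : forall f, C2c f -> forall x,
    t^-1 * (kernel_op (fun t => P t) t f x - f x) @[t --> 0^'+]
      --> generator (gradient gamma) f x;
  cd_density : forall t, 0 < t -> forall x A, measurable A ->
    P t x A = (\int[lebesgue_rV R n]_(y in A) (p t x y)%:E)%E;
  cd_measurable : forall t, 0 < t ->
    measurable_fun [set: borel Rn * borel Rn] (fun z => p t z.1 z.2);
  cd_positive : forall t, 0 < t -> forall x y, 0 < p t x y;
  cd_conservative : forall t, 0 < t -> forall x,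
    (\int[lebesgue_rV R n]_y (p t x y)%:E)%E = 1%E;
  cd_symmetric : forall t, 0 < t -> forall x y,
    nu gamma x * p t x y = nu gamma y * p t y x }.

End diffusion.

Section duality.
Context (R : realType) (n : nat) d (Dstar : measurableType d).
Local Notation Rn := 'rV[R]_n.

Definition liggett_dual (P : R -> R.-pker (borel Rn) ~> (borel Rn))
    (Q : R -> R.-spker Dstar ~> Dstar) (Gam : Dstar -> Rn -> R) : Prop :=
  forall t, 0 <= t -> forall (xs : Dstar) (x : Rn),
    (\int[P t x]_y (Gam xs y)%:E = \int[Q t xs]_ys (Gam ys x)%:E)%E.

Definition is_link (lam : Dstar -> Rn -> R) : Prop :=
  [/\ measurable_fun [set: Dstar * borel Rn] (fun z => lam z.1 z.2),
      forall xs x, 0 <= lam xs x &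
      forall xs, (\int[lebesgue_rV R n]_x (lam xs x)%:E)%E = 1%E].

Definition link_op (lam : Dstar -> Rn -> R) (f : Rn -> R) (xs : Dstar) : R :=
  \int[lebesgue_rV R n]_x (lam xs x * f x).

Definition intertwining_dual (P : R -> R.-pker (borel Rn) ~> (borel Rn))
    (Qs : R -> (Dstar -> R) -> Dstar -> R) (lam : Dstar -> Rn -> R) : Prop :=
  [/\ is_link lam, markov_semigroup Qs &
      forall f : borel Rn -> R, bounded_measurable f -> forall t, 0 <= t ->
        link_op lam (kernel_op (fun t => P t) t f) =1 Qs t (link_op lam f)].

Definition dual_weight (gamma : Rn -> R) (Gam : Dstar -> Rn -> R) (xs : Dstar) :
    \bar R :=
  (\int[lebesgue_rV R n]_x (Gam xs x * nu gamma x)%:E)%E.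

End duality.

(* Main.v *)
Require Import Defs.
From HB Require Import structures.
From mathcomp Require Import all_boot all_order all_algebra.
From mathcomp Require Import all_classical all_reals all_analysis.
From mathcomp Require Import measurable_realfun.

Set Implicit Arguments.
Unset Strict Implicit.
Unset Printing Implicit Defensive.

Import Order.TTheory GRing.Theory Num.Theory.
Import numFieldNormedType.Exports.

Local Open Scope classical_set_scope.
Local Open Scope ring_scope.

(** Two facts drive the proof. The semigroup P_t is reversible for the measure
nu(x) dx, so for nonnegative u and v

  int nu u (P_t v) dx = int nu v (P_t u) dx,

and Liggett duality says that P_t acting on the second variable of Gamma is
Q_t acting on the first one. For a nonnegative function g on R^n and a point xs
of the dual space, let Hg(xs) = int Gamma(xs, x) nu(x) g(x) dx. Applying Tonelli,
then duality, then reversibility with u = g and v = Gamma(xs, .) gives the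
transfer identity

  Q_t [Hg] = H [P_t g]

(lemma [dual_transfer]).

With g = 1 it reads Q_t h = h: the weight h is harmonic for the sub-Markov
semigroup Q_t, and Q*_t is its Doob transform by h, hence a Markov semigroup
([doob_semigroup]). For a general g, dividing by h(xs) gives
Q*_t [Lambda g] = Lambda [P_t g], because Hg = h (Lambda g).

Everything is thus obtained for nonnegative functions with extended real
integrals. As Lambda, P_t and Q*_t are all integrals against probability
kernels, the identity passes to a bounded f by applying it to f + M >= 0 and
subtracting the constant M ([pker_commute_bounded]). *)

(** * Measures and kernels with a density *)

Section density.
Context d (T : measurableType d) (R : realType).
Variables (m mu : {measure set T -> \bar R}) (f : T -> R).
Hypotheses (f0 : forall x, 0 <= f x) (mf : measurable_fun setT f).
Hypothesis muE : forall A, measurable A -> mu A = (\int[m]_(x in A) (f x)%:E)%E.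
Local Open Scope ereal_scope.

Import HBNNSimple.

Let fe0 x : 0 <= (f x)%:E. Proof. by rewrite lee_fin. Qed.

Let mfe : measurable_fun [set: T] (EFin \o f).
Proof. exact/measurable_EFinP. Qed.

Let ge0_integral_density_nnsfun (h : {nnsfun T >-> R}) :
  \int[mu]_x (h x)%:E = \int[m]_x ((f x)%:E * (h x)%:E).
Proof.
have hE x : (h x)%:E =
    \sum_(r \in range h) (r%:E * (\1_(h @^-1` [set r]) x)%:E).
  by rewrite fimfunE -fsumEFin//; apply: eq_fsbigr => r _; rewrite EFinM.
have mh r : measurable_fun setT (fun x => r%:E * (\1_(h @^-1` [set r]) x)%:E).
  by apply: measurable_funeM; exact/measurable_EFinP.
have h0 r x : 0 <= r%:E * (\1_(h @^-1` [set r]) x)%:E.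
  by rewrite -EFinM nnfun_muleindic_ge0.
under eq_integral do rewrite hE.
rewrite ge0_integral_fsum//.
transitivity (\int[m]_x \sum_(r \in range h)
    ((f x)%:E * (r%:E * (\1_(h @^-1` [set r]) x)%:E))); last first.
  by apply: eq_integral => x _; rewrite hE ge0_mule_fsumr.
rewrite ge0_integral_fsum//; last 2 first.
- by move=> r; exact: emeasurable_funM.
- by move=> r x _; exact: mule_ge0.
apply: eq_fsbigr => r _.
have [r0|r0] := leP 0%R r; last first.
  by rewrite !integral0_eq// => x _; rewrite preimage_nnfun0// indic0 !mule0.
rewrite ge0_integralZl//; last exact/measurable_EFinP.
under [RHS]eq_integral do rewrite muleCA.
rewrite ge0_integralZl//; last 2 first.
- by apply: emeasurable_funM => //; exact/measurable_EFinP.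
- by move=> x _; apply: mule_ge0 => //; rewrite lee_fin.
congr (_ * _); rewrite integral_indic// setIT muE//.
rewrite [LHS]integral_mkcond; apply: eq_integral => x _.
by rewrite epatch_indic.
Qed.

Let ge0_integral_density g : (forall x, 0 <= g x) -> measurable_fun setT g ->
  \int[mu]_x g x = \int[m]_x ((f x)%:E * g x).
Proof.
move=> g0 mg; pose h := nnsfun_approx measurableT mg.
have hg x : (h n x)%:E @[n --> \oo] --> g x by exact: cvg_nnsfun_approx.
have ndh x : {homo (fun n => (h n x)%:E) : a b / (a <= b)%N >-> a <= b}.
  by move=> a b ab; rewrite lee_fin; exact/lefP/nd_nnsfun_approx.
transitivity (limn (fun n => \int[mu]_x (h n x)%:E)).
  rewrite -monotone_convergence//.
  - by apply: eq_integral => x _; apply/esym/cvg_lim => //; exact: hg.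
  - by move=> n; exact/measurable_EFinP.
  - by move=> n x _; rewrite lee_fin.
transitivity (limn (fun n => \int[m]_x ((f x)%:E * (h n x)%:E))).
  by under eq_fun do rewrite ge0_integral_density_nnsfun.
rewrite -monotone_convergence//.
- apply: eq_integral => x _; apply/cvg_lim => //.
  by apply: cvgeZl => //; exact: hg.
- by move=> n; apply: emeasurable_funM => //; exact/measurable_EFinP.
- by move=> n x _; apply: mule_ge0 => //; rewrite lee_fin.
- by move=> x _ a b ab; apply: lee_wpmul2l => //; exact: ndh.
Qed.

(** The signed case reduces to the nonnegative one because multiplying by
[f >= 0] commutes with taking positive and negative parts. *)
Lemma integral_density g : measurable_fun setT g ->
  \int[mu]_x g x = \int[m]_x ((f x)%:E * g x).
Proof.
move=> mg; rewrite integralE [RHS]integralE.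
rewrite !ge0_integral_density//;
  [|exact: measurable_funeneg|exact: measurable_funepos].
congr (_ - _); apply: eq_integral => x _; last first.
- rewrite [RHS]funenegE funenegE maxe_pMr// mule0 ?muleN//.
- by rewrite [RHS]funeposE funeposE maxe_pMr// mule0.
Qed.

End density.

(** The first hypothesis is what measurability of the new kernel rests on. Stated
this way the lemma serves for [l] a sub-Markov kernel (Doob transform) as well
as for [l] constantly equal to Lebesgue measure (the link). *)
Lemma density_pker d d' (X : measurableType d) (Y : measurableType d')
    (R : realType) (l : X -> {measure set Y -> \bar R}) (f : X -> Y -> R) :
  (forall g : X * Y -> \bar R, (forall z, 0 <= g z)%E -> measurable_fun setT g ->
    measurable_fun setT (fun x => \int[l x]_y g (x, y))%E) ->
  measurable_fun [set: X * Y] (fun z => f z.1 z.2) ->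
  (forall x y, 0 <= f x y) ->
  (forall x, \int[l x]_y (f x y)%:E = 1)%E ->
  exists k : R.-pker X ~> Y,
    forall x A, measurable A -> k x A = (\int[l x]_(y in A) (f x y)%:E)%E.
Proof.
move=> ml mf f0 f1.
pose k0 x (A : set Y) := (\int[l x]_(y in A) (f x y)%:E)%E.
have mfx x : measurable_fun setT (fun y => (f x y)%:E).
  apply/measurable_EFinP.
  exact: (measurableT_comp mf (pair1_measurable x)).
have k00 x : k0 x set0 = 0%E by rewrite /k0 integral_set0.
have k0_ge0 x A : (0 <= k0 x A)%E.
  by apply: integral_ge0 => y _; rewrite lee_fin.
have k0_add x : semi_sigma_additive (k0 x).
  by apply: semi_sigma_additive_nng_induced => // y; rewrite lee_fin.
pose mk x := isMeasure.Build _ _ _ (k0 x) (k00 x) (@k0_ge0 x) (@k0_add x).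
pose k1 x : {measure set Y -> \bar R} := HB.pack (k0 x) (mk x).
have mk1 U : measurable U -> measurable_fun setT (k1 ^~ U).
  move=> mU; rewrite (_ : k1 ^~ U = fun x => \int[l x]_y
      ((f x y)%:E * (\1_([set: X] `*` U) (x, y))%:E))%E.
    apply: (ml (fun z => (f z.1 z.2)%:E * (\1_([set: X] `*` U) z)%:E)%E) => [z|].
      by rewrite mule_ge0 ?lee_fin.
    apply: emeasurable_funM; first exact/measurable_EFinP.
    by apply/measurable_EFinP/measurable_indic; exact: measurableX.
  apply/funext => x; rewrite /= /k0 integral_mkcond.
  apply: eq_integral => y _; rewrite epatch_indic/=; congr (_ * (_)%:E)%E.
  by rewrite !indicE; congr (_%:R); apply/f_equal; apply/idP/idP;
    rewrite !inE => //= -[].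
pose Mk := isKernel.Build _ _ _ _ _ k1 mk1.
pose k2 : R.-ker X ~> Y := HB.pack k1 Mk.
have k21 x : k2 x setT = 1%E by exact: f1.
pose Pk := Kernel_isProbability.Build _ _ _ _ _ k2 k21.
pose k3 : R.-pker X ~> Y := HB.pack k1 Mk Pk.
by exists k3.
Qed.

Lemma ge0_integral_comp_kernel d1 d2 d3 (X : measurableType d1)
    (Y : measurableType d2) (Z : measurableType d3) (R : realType)
    (k1 : R.-spker X ~> Y) (k2 : R.-spker Y ~> Z)
    (mu : {measure set Z -> \bar R}) (x : X) (g : Z -> \bar R) :
  (forall A, measurable A -> mu A = (\int[k1 x]_y k2 y A)%E) ->
  (forall z, 0 <= g z)%E -> measurable_fun setT g ->
  (\int[mu]_z g z = \int[k1 x]_y \int[k2 y]_z g z)%E.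
Proof.
move=> muE g0 mg.
transitivity
  (\int[mkcomp k1 (@kernel.kernel_snd _ _ _ X Y Z R k2) x]_z g z)%E.
  by apply: eq_measure_integral => A mA _; exact: muE.
exact: (@integral_kcomp _ _ _ _ _ _ _ k1 (kernel.kernel_snd k2) x g g0 mg).
Qed.

Lemma measurable_funV_gt0 d (T : measurableType d) (R : realType) (f : T -> R) :
  measurable_fun setT f -> (forall x, 0 < f x) ->
  measurable_fun [set: T] (fun x => (f x)^-1).
Proof.
move=> mf f0; rewrite (_ : (fun x => _) = (fun x => f x `^ (-1))); last first.
  by apply/funext => x; rewrite powR_inv1// ltW.
exact: (measurableT_comp (measurable_powR (-1)) mf).
Qed.

(** * Doob transform of a sub-Markov semigroup *)

Section doob_transform.
Context (R : realType) d (S : measurableType d) (h : S -> R).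
Hypotheses (mh : measurable_fun setT h) (h0 : forall x, 0 < h x).

Let ratio_ge0 x y : 0 <= h y / h x. Proof. by rewrite divr_ge0// ltW. Qed.

Let ratio_measurable x : measurable_fun setT (fun y => h y / h x).
Proof. exact: measurable_funM. Qed.

(** Harmonicity of [h] is exactly what makes the total mass equal to 1. *)
Lemma doob_pker (Q : R.-spker S ~> S) :
  (forall x, \int[Q x]_y (h y)%:E = (h x)%:E)%E ->
  exists K : R.-pker S ~> S, forall x A, measurable A ->
    K x A = (\int[Q x]_(y in A) (h y / h x)%:E)%E.
Proof.
move=> Qh; apply: (@density_pker _ _ _ _ _ Q (fun x y => h y / h x)).
- by move=> g g0 mg; exact: measurable_fun_integral_sfinite_kernel.
- apply: measurable_funM; first by apply: measurableT_comp.
  by apply: (measurableT_comp (measurable_funV_gt0 mh h0)).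
- exact: ratio_ge0.
move=> x; under eq_integral do rewrite mulrC EFinM.
rewrite ge0_integralZl//; last 3 first.
- exact/measurable_EFinP.
- by move=> y _; rewrite lee_fin ltW.
- by rewrite lee_fin invr_ge0 ltW.
by rewrite Qh -EFinM mulVf// gt_eqF.
Qed.

(** The factors [h] telescope: the density [h z / h x] over two steps is
[(h z / h y) * (h y / h x)], so Chapman-Kolmogorov for [Q] gives it for [K]. *)
Lemma doob_semigroup (Q : R -> R.-spker S ~> S) :
  transition_semigroup (fun t => Q t) ->
  (forall t, 0 <= t -> forall x, (\int[Q t x]_y (h y)%:E = (h x)%:E)%E) ->
  exists2 K : R -> R.-pker S ~> S, transition_semigroup (fun t => K t) &
    forall t, 0 <= t -> forall x A, measurable A ->
      K t x A = (\int[Q t x]_(y in A) (h y / h x)%:E)%E.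
Proof.
move=> [Q0 QD] Qh.
have /choice[K KE] t : exists K : R.-pker S ~> S, 0 <= t -> forall x A,
    measurable A -> K x A = (\int[Q t x]_(y in A) (h y / h x)%:E)%E.
  have [t0|t0] := leP 0 t.
    by have [K KE] := doob_pker (Qh t t0); exists K.
  (* at negative times any kernel will do *)
  by have [K _] := doob_pker (Qh 0 (lexx 0)); exists K.
exists K => //; split=> [x A mA|s t s0 t0 x A mA].
  rewrite KE// (eq_measure_integral \d_x); last by move=> B mB _; exact: Q0.
  rewrite integral_dirac//; last first.
    by apply/measurable_EFinP; exact: measurable_funTS.
  by rewrite divff ?mule1// gt_eqF.
rewrite KE ?addr_ge0// integral_mkcond.
pose g y := ((h y)%:E * (\1_A y)%:E)%E.
have g0 y : (0 <= g y)%E by rewrite /g mule_ge0 ?lee_fin// ltW.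
have mg : measurable_fun setT g.
  by apply: emeasurable_funM; apply/measurable_EFinP.
have gE y z : ((fun z => (h z / h y)%:E) \_ A) z = ((h y)^-1%:E * g z)%E.
  by rewrite epatch_indic /g muleA; congr (_ * _)%E; rewrite -EFinM mulrC.
under eq_integral do rewrite gE.
have hV0 y : (0 <= (h y)^-1%:E)%E by rewrite lee_fin invr_ge0 ltW.
rewrite ge0_integralZl//.
rewrite (ge0_integral_comp_kernel (k1 := Q s) (k2 := Q t) (x := x))//; last first.
  by move=> B mB; exact: QD.
rewrite (integral_density (f := fun y => h y / h x) (m := Q s x)
  (mu := K s x))//; last 2 first.
- by move=> B mB; exact: KE.
- exact: measurable_kernel.
rewrite -ge0_integralZl//; last 2 first.
- by apply: measurable_fun_integral_kernel => //; exact: measurable_kernel.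
- by move=> y _; exact: integral_ge0.
apply: eq_integral => y _.
rewrite KE// [in RHS]integral_mkcond.
under [in RHS]eq_integral do rewrite gE.
rewrite ge0_integralZl// muleA -EFinM; congr (_%:E * _)%E.
by rewrite -mulrA mulrCA divff ?mulr1// gt_eqF.
Qed.

End doob_transform.

(** * Bounded functions and probability kernels *)

Section bounded_measurable.
Context d (T : measurableType d) (R : realType).
Implicit Type f : T -> R.

Lemma bounded_measurableP f : bounded_measurable f <->
  measurable_fun setT f /\ exists M : R, forall x, `|f x| <= M.
Proof.
split=> -[mf].
  move=> [M [_ fM]]; split=> //; exists (M + 1) => x.
  by apply: fM => //; rewrite ltrDl.
move=> [M fM]; split=> //; exists M; split; first exact: num_real.
by move=> y /ltW My x _; exact: le_trans My.
Qed.

Lemma bounded_measurable_addr f c :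
  bounded_measurable f -> bounded_measurable (fun x => f x + c).
Proof.
move=> /bounded_measurableP[mf [M fM]]; apply/bounded_measurableP; split.
  exact: measurable_funD.
by exists (M + `|c|) => x; rewrite (le_trans (ler_normD _ _))// lerD2r.
Qed.

Lemma bounded_measurable_integrable (mu : {measure set T -> \bar R}) f :
  mu setT = 1%E -> bounded_measurable f -> mu.-integrable setT (EFin \o f).
Proof.
by move=> mu1 [mf bf]; apply: measurable_bounded_integrable; rewrite // mu1 ltry.
Qed.

Lemma Rintegral_addr (mu : {measure set T -> \bar R}) f c :
  mu setT = 1%E -> bounded_measurable f ->
  \int[mu]_x (f x + c) = \int[mu]_x f x + c.
Proof.
move=> mu1 bf; rewrite RintegralD//.
- by rewrite Rintegral_cst// mu1 mulr1.
- exact: bounded_measurable_integrable.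
- apply: bounded_measurable_integrable => //; apply/bounded_measurableP.
  by split=> //; exists `|c|.
Qed.

End bounded_measurable.

Section pker_Rintegral.
Context d d' (X : measurableType d) (Y : measurableType d') (R : realType).
Variable k : R.-pker X ~> Y.

Lemma EFin_Rintegral_pker f x : bounded_measurable f ->
  (\int[k x]_y f y)%:E = (\int[k x]_y (f y)%:E)%E.
Proof.
move=> bf; rewrite fineK//; apply: integrable_fin_num => //.
by apply: bounded_measurable_integrable => //; exact: prob_kernel.
Qed.

Lemma bounded_measurable_pker f : bounded_measurable f ->
  bounded_measurable (fun x => \int[k x]_y f y).
Proof.
move=> bf; have /bounded_measurableP[mf [M fM]] := bf.
have bfM := bounded_measurable_addr M bf.
apply/bounded_measurableP; split.
  rewrite (_ : (fun x => _) = (fun x => \int[k x]_y (f y + M) + - M)).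
    apply: measurable_funD => //; apply/measurable_EFinP.
    rewrite (_ : EFin \o _ = fun x => \int[k x]_y (f y + M)%:E)%E; last first.
      by apply/funext => x; exact: EFin_Rintegral_pker.
    apply: measurable_fun_integral_kernel.
    - by move=> U mU; exact: measurable_kernel.
    - move=> y; rewrite lee_fin -lerBlDr sub0r.
      by have := fM y; rewrite ler_norml => /andP[].
    - by apply/measurable_EFinP; case: bfM.
  by apply/funext => x; rewrite Rintegral_addr ?addrK//; exact: prob_kernel.
exists M => x; rewrite -lee_fin.
rewrite EFin_normr_Rintegral//; last first.
  by apply: bounded_measurable_integrable => //; exact: prob_kernel.
apply: (le_trans (le_abse_integral _ measurableT _)).
  exact/measurable_EFinP.
have -> : M%:E = (\int[k x]_y M%:E)%E.
  by rewrite integral_cst//= prob_kernel mule1.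
apply: ge0_le_integral => //.
- by apply: measurableT_comp => //; exact/measurable_EFinP.
- by move=> y _; rewrite lee_fin.
Qed.

End pker_Rintegral.

(** Adding a constant to the function adds it to both sides, as the kernels have
mass 1. It therefore suffices to compare the two sides at a nonnegative
function, where extended real integrals make integrability issues disappear. *)
Lemma pker_commute_bounded d1 d2 d3 d4 (X : measurableType d1)
    (Y : measurableType d2) (Y' : measurableType d3) (Z : measurableType d4)
    (R : realType) (a : R.-pker X ~> Y) (b : R.-pker Y ~> Z)
    (a' : R.-pker X ~> Y') (b' : R.-pker Y' ~> Z) :
  (forall (f : Z -> \bar R) x, (forall z, 0 <= f z)%E -> measurable_fun setT f ->
    (\int[a x]_y \int[b y]_z f z = \int[a' x]_y \int[b' y]_z f z)%E) ->
  forall (f : Z -> R) x, bounded_measurable f ->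
    \int[a x]_y (\int[b y]_z f z) = \int[a' x]_y (\int[b' y]_z f z).
Proof.
move=> abE f x bf; have /bounded_measurableP[mf [M fM]] := bf.
have bfM := bounded_measurable_addr M bf.
have shift d5 (W : measurableType d5) (k : R.-pker X ~> W) (l : R.-pker W ~> Z) :
    \int[k x]_y (\int[l y]_z f z) + M =
    fine (\int[k x]_y \int[l y]_z (f z + M)%:E)%E.
  rewrite -Rintegral_addr ?prob_kernel//; last exact: bounded_measurable_pker.
  congr fine; apply: eq_integral => y _.
  by rewrite -Rintegral_addr ?prob_kernel// EFin_Rintegral_pker.
apply: (addIr M); rewrite !shift abE//.
- move=> z; rewrite lee_fin -lerBlDr sub0r.
  by have := fM z; rewrite ler_norml => /andP[].
- by apply/measurable_EFinP; case: bfM.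
Qed.

(** * Reversibility and transfer of duality *)

(** Both sides are the double integral of [w x * p x y * u x * v y], up to the
exchange of [x] and [y] that detailed balance permits. *)
Lemma symmetric_density_reversible d (Y : measurableType d) (R : realType)
    (m : {sigma_finite_measure set Y -> \bar R}) (w : Y -> R)
    (p : Y -> Y -> R) (P : Y -> {measure set Y -> \bar R}) :
  measurable_fun setT w -> (forall x, 0 <= w x) ->
  measurable_fun [set: Y * Y] (fun z => p z.1 z.2) -> (forall x y, 0 <= p x y) ->
  (forall x y, w x * p x y = w y * p y x) ->
  (forall x A, measurable A -> P x A = (\int[m]_(y in A) (p x y)%:E)%E) ->
  forall u v : Y -> \bar R, (forall x, 0 <= u x)%E -> (forall x, 0 <= v x)%E ->
    measurable_fun setT u -> measurable_fun setT v ->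
  (\int[m]_x ((w x)%:E * (u x * \int[P x]_y v y)) =
   \int[m]_x ((w x)%:E * (v x * \int[P x]_y u y)))%E.
Proof.
move=> mw w0 mp p0 pC PE.
have mpx x : measurable_fun setT (p x).
  exact: (measurableT_comp mp (pair1_measurable x)).
have int u v : (forall x, 0 <= u x)%E -> (forall x, 0 <= v x)%E ->
    measurable_fun setT u -> measurable_fun setT v ->
  (\int[m]_x ((w x)%:E * (u x * \int[P x]_y v y)) =
   \int[m]_x \int[m]_y ((w x * p x y)%:E * (u x * v y)))%E.
  move=> u0 v0 mu mv; apply: eq_integral => x _.
  rewrite (integral_density (f := p x) (m := m))//; last exact: PE.
  rewrite muleA -ge0_integralZl//.
  - by apply: eq_integral => y _; rewrite EFinM muleACA.
  - by apply: emeasurable_funM => //; exact/measurable_EFinP.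
  - by move=> y _; rewrite mule_ge0// lee_fin.
  - by rewrite mule_ge0// lee_fin.
move=> u v u0 v0 mu mv; rewrite int// int//.
rewrite (fubini_tonelli (fun z => (w z.1 * p z.1 z.2)%:E * (u z.1 * v z.2))%E)//=.
- apply: eq_integral => y _; apply: eq_integral => x _.
  by rewrite pC [(u x * _)%E]muleC.
- apply: emeasurable_funM.
    apply/measurable_EFinP; apply: measurable_funM => //.
    by apply: (measurableT_comp mw).
  by apply: emeasurable_funM;
    [apply: (measurableT_comp mu)|apply: (measurableT_comp mv)].
- by move=> z; rewrite !mule_ge0// lee_fin mulr_ge0.
Qed.

(** Exchange the integrals to bring the action of [Q] on [G], turn it by duality
into the action of [P], and move [P] over to [g] by reversibility. *)
Lemma dual_transfer d d' (X : measurableType d) (Y : measurableType d')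
    (R : realType) (m : {sigma_finite_measure set Y -> \bar R}) (w : Y -> R)
    (P : Y -> {measure set Y -> \bar R}) (Q : R.-sfker X ~> X) (G : X -> Y -> R) :
  measurable_fun setT w -> (forall x, 0 <= w x) ->
  measurable_fun [set: X * Y] (fun z => G z.1 z.2) -> (forall x y, 0 <= G x y) ->
  (forall u v : Y -> \bar R, (forall x, 0 <= u x)%E -> (forall x, 0 <= v x)%E ->
    measurable_fun setT u -> measurable_fun setT v ->
    (\int[m]_x ((w x)%:E * (u x * \int[P x]_y v y)) =
     \int[m]_x ((w x)%:E * (v x * \int[P x]_y u y)))%E) ->
  (forall x y, (\int[P y]_z (G x z)%:E = \int[Q x]_z (G z y)%:E)%E) ->
  forall (g : Y -> \bar R) x, (forall y, 0 <= g y)%E -> measurable_fun setT g ->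
  (\int[Q x]_z \int[m]_y ((w y)%:E * ((G z y)%:E * g y)) =
   \int[m]_y ((w y)%:E * ((G x y)%:E * \int[P y]_z g z)))%E.
Proof.
move=> mw w0 mG G0 Prev PQ g x g0 mg.
pose Qx : {sfinite_measure set X -> \bar R} :=
  HB.pack (Q x : set X -> \bar R) (Measure.class (Q x))
    (isSFinite.Build _ _ _ (Q x) (sfinite_kernel_measure Q x)).
have mGx : measurable_fun setT (fun y => (G x y)%:E).
  by apply/measurable_EFinP; exact: (measurableT_comp mG (pair1_measurable x)).
have mGy y : measurable_fun setT (fun z => (G z y)%:E).
  by apply/measurable_EFinP; exact: (measurableT_comp mG (pair2_measurable y)).
transitivity (\int[m]_y \int[Q x]_z ((w y)%:E * ((G z y)%:E * g y)))%E.
  rewrite -[LHS]/(\int[Qx]_z \int[m]_y ((w y)%:E * ((G z y)%:E * g y)))%E.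
  apply: (@sfinite_Fubini _ _ _ _ _ Qx m
    (fun z => (w z.2)%:E * ((G z.1 z.2)%:E * g z.2))%E).
  - by move=> z; rewrite !mule_ge0// lee_fin.
  - apply: emeasurable_funM.
      by apply/measurable_EFinP; apply: (measurableT_comp mw).
    apply: emeasurable_funM; first exact/measurable_EFinP.
    by apply: (measurableT_comp mg).
rewrite Prev//; last by move=> y; rewrite lee_fin.
apply: eq_integral => y _; rewrite PQ.
under eq_integral do rewrite [(_ * g y)%E]muleC muleA.
rewrite ge0_integralZl ?muleA//.
- by move=> z _; rewrite lee_fin.
- by rewrite mule_ge0// lee_fin.
Qed.

(** * Intertwining for the characteristic diffusion *)

Lemma measurable_fun_borel_continuous (T : ptopologicalType) (R : realType)
    (f : T -> R) :
  continuous f -> measurable_fun [set: borel T] (f : borel T -> R).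
Proof.
move=> cf; apply: (@measurability _ _ (borel T) R _ _ (@RGenOpens.G R)).
  exact: RGenOpens.measurableE.
move=> _ [_ [a [b ->]] <-]; rewrite setTI; apply: sub_sigma_algebra.
by apply: open_comp; [move=> x _; exact: cf|exact: interval_open].
Qed.

(** There is a transition density only at positive times; at time 0 the kernel is
the Dirac mass and both sides coincide. *)
Lemma characteristic_diffusion_reversible (R : realType) (n : nat)
    (gamma : 'rV[R]_n -> R)
    (P : R -> R.-pker (borel 'rV[R]_n) ~> (borel 'rV[R]_n))
    (p : R -> 'rV[R]_n -> 'rV[R]_n -> R) :
  measurable_fun [set: borel 'rV[R]_n] (nu gamma) ->
  characteristic_diffusion gamma P p ->
  forall t, 0 <= t -> forall u v : borel 'rV[R]_n -> \bar R,
    (forall x, 0 <= u x)%E -> (forall x, 0 <= v x)%E ->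
    measurable_fun setT u -> measurable_fun setT v ->
  (\int[lebesgue_rV R n]_x ((nu gamma x)%:E * (u x * \int[P t x]_y v y)) =
   \int[lebesgue_rV R n]_x ((nu gamma x)%:E * (v x * \int[P t x]_y u y)))%E.
Proof.
move=> mnu Pd t; rewrite le_eqVlt => /predU1P[<-|t0] u v u0 v0 mu mv.
  have P0 (w : borel 'rV[R]_n -> \bar R) x : measurable_fun setT w ->
      (\int[P 0%R x]_y w y = w x)%E.
    move=> mw; rewrite (eq_measure_integral \d_x).
      by rewrite integral_dirac// diracT mul1e.
    by move=> A mA _; rewrite (cd_semigroup Pd).1.
  by apply: eq_integral => x _; rewrite !P0// [(u x * _)%E]muleC.
apply: (@symmetric_density_reversible _ (borel 'rV[R]_n) R (lebesgue_rV R n)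
  (nu gamma) (p t)) => //.
- by move=> x; exact: expR_ge0.
- exact: (cd_measurable Pd).
- by move=> x y; exact/ltW/(cd_positive Pd).
- exact: (cd_symmetric Pd).
- exact: (cd_density Pd).
Qed.

Theorem proposition3p4 (R : realType) (n : nat) (gamma : 'rV[R]_n -> R)
    (P : R -> R.-pker (borel 'rV[R]_n) ~> (borel 'rV[R]_n))
    (p : R -> 'rV[R]_n -> 'rV[R]_n -> R)
    (Dstar : ptopologicalType)
    (Q : R -> R.-spker (borel Dstar) ~> (borel Dstar))
    (Gam : borel Dstar -> 'rV[R]_n -> R)
    (gammaC1 : C1 gamma)
    (Pdiff : characteristic_diffusion gamma P p)
    (DstarP : polish_space R Dstar)
    (Qsemi : transition_semigroup (fun t => Q t))
    (Gam_meas : measurable_fun [set: borel Dstar * borel 'rV[R]_n]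
       (fun z => Gam z.1 z.2))
    (Gam_ge0 : forall xs x, 0 <= Gam xs x)
    (Gam_bounded : exists M : R, forall xs x, Gam xs x <= M)
    (PQdual : liggett_dual P Q Gam)
    (hfin : forall xs, (0 < dual_weight gamma Gam xs < +oo)%E) :
  let h := fun xs => fine (dual_weight gamma Gam xs) in
  let Qs := fun t (f : borel Dstar -> R) xs =>
    (h xs)^-1 * kernel_op (fun t => Q t) t (fun ys => h ys * f ys) xs in
  let lam := fun xs x => Gam xs x / h xs * nu gamma x in
  intertwining_dual P Qs lam.
Proof.
move=> h Qs lam.
pose Rn : measurableType _ := borel 'rV[R]_n.
pose m := lebesgue_rV R n.
have mnu : measurable_fun [set: Rn] (nu gamma).
  apply: (measurableT_comp (@measurable_expR R)).
  apply: measurable_funM => //; apply: measurable_fun_borel_continuous => x.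
  exact/differentiable_continuous/gammaC1.1.
have nu0 x : 0 <= nu gamma x by exact: expR_ge0.
have mGnu : measurable_fun [set: borel Dstar * Rn]
    (fun z => (Gam z.1 z.2 * nu gamma z.2)%:E).
  apply/measurable_EFinP; apply: measurable_funM => //.
  by apply: (measurableT_comp mnu).
have hE xs : (h xs)%:E = (\int[m]_x (Gam xs x * nu gamma x)%:E)%E.
  by have /andP[? ?] := hfin xs; rewrite fineK// ge0_fin_numE// ltW.
have h0 xs : 0 < h xs by apply: fine_gt0; exact: hfin.
have mh : measurable_fun [set: borel Dstar] h.
  apply/measurable_EFinP.
  rewrite (_ : EFin \o h =
      fubini_F m (fun z => (Gam z.1 z.2 * nu gamma z.2)%:E)).
    by apply: measurable_fun_fubini_tonelli_F => // z; rewrite lee_fin mulr_ge0.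
  by apply/funext => xs; exact: hE.
(* [Q_t (H f) = H (P_t f)], where [H f] integrates [f] against [Gam * nu] *)
have transfer t (f : Rn -> \bar R) xs : 0 <= t -> (forall x, 0 <= f x)%E ->
    measurable_fun setT f ->
    (\int[Q t xs]_ys \int[m]_x ((nu gamma x)%:E * ((Gam ys x)%:E * f x)) =
     \int[m]_x ((nu gamma x)%:E * ((Gam xs x)%:E * \int[P t x]_y f y)))%E.
  move=> t0 f0 mf.
  apply: (@dual_transfer _ _ (borel Dstar) Rn R m (nu gamma) (P t) (Q t)) => //.
  - exact: (characteristic_diffusion_reversible mnu Pdiff).
  - by move=> ys x; exact: PQdual.
have Qh t : 0 <= t -> forall xs, (\int[Q t xs]_ys (h ys)%:E = (h xs)%:E)%E.
  move=> t0 xs; have := transfer t (cst 1%E) xs t0 (fun=> lee01) (measurable_cst _).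
  under eq_integral.
    move=> ys _; under eq_integral do rewrite mule1 -EFinM mulrC.
    rewrite -hE; over.
  move=> ->; rewrite hE; apply: eq_integral => x _.
  by rewrite integral_cst//= prob_kernel !mule1 -EFinM mulrC.
have [K Ksemi KE] := doob_semigroup mh h0 Qsemi Qh.
have mlam : measurable_fun [set: borel Dstar * Rn] (fun z => lam z.1 z.2).
  apply: measurable_funM; last by apply: (measurableT_comp mnu).
  apply: measurable_funM => //.
  by apply: (measurableT_comp (measurable_funV_gt0 mh h0)).
have lam0 xs x : 0 <= lam xs x by rewrite mulr_ge0// divr_ge0// ltW.
have mlamx xs : measurable_fun [set: Rn] (lam xs).
  exact: (measurableT_comp mlam (pair1_measurable xs)).
have mGx xs : measurable_fun [set: Rn] (Gam xs).
  exact: (measurableT_comp Gam_meas (pair1_measurable xs)).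
have lamE xs (g : Rn -> \bar R) : (forall x, 0 <= g x)%E -> measurable_fun setT g ->
    (\int[m]_x ((lam xs x)%:E * g x) =
     (h xs)^-1%:E * \int[m]_x ((nu gamma x)%:E * ((Gam xs x)%:E * g x)))%E.
  move=> g0 mg; rewrite -ge0_integralZl//.
  - apply: eq_integral => x _; rewrite !muleA -!EFinM; congr (_%:E * _)%E.
    by rewrite /lam [_ / _]mulrC mulrAC.
  - apply: emeasurable_funM; first exact/measurable_EFinP.
    by apply: emeasurable_funM => //; exact/measurable_EFinP.
  - by move=> x _; rewrite !mule_ge0 ?lee_fin.
  - by rewrite lee_fin invr_ge0 ltW.
have lam1 xs : (\int[m]_x (lam xs x)%:E = 1)%E.
  transitivity (\int[m]_x ((lam xs x)%:E * cst 1 x))%E.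
    by apply: eq_integral => x _; rewrite mule1.
  rewrite lamE//; under eq_integral do rewrite mule1 -EFinM mulrC.
  by rewrite -hE -EFinM mulVf// gt_eqF.
have [L LE] : exists L : R.-pker (borel Dstar) ~> Rn, forall xs A, measurable A ->
    L xs A = (\int[m]_(x in A) (lam xs x)%:E)%E.
  apply: (@density_pker _ _ (borel Dstar) Rn R (fun=> m)) => // g g0 mg.
  exact: measurable_fun_fubini_tonelli_F.
have linkE f xs : measurable_fun [set: Rn] f -> link_op lam f xs = \int[L xs]_x f x.
  move=> mf; congr fine; rewrite (integral_density (f := lam xs) (m := m) (mu := L xs))//.
  - exact: LE.
  - exact/measurable_EFinP.
have QsE t : 0 <= t -> forall f, bounded_measurable f ->
    Qs t f =1 kernel_op (fun t => K t) t f.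
  move=> t0 f bf xs; have /bounded_measurableP[mf [M fM]] := bf.
  rewrite /Qs /kernel_op -RintegralZl//; last first.
    (* [h * f] is dominated by [M * h], and [h] is integrable since [Q_t h = h] *)
    apply: (le_integrable measurableT (g := fun ys => (M%:E * (h ys)%:E)%E)).
    - by apply/measurable_EFinP; exact: measurable_funM.
    - move=> ys _; rewrite /= lee_fin mulrC !normrM ler_wpM2r//.
      by rewrite (le_trans (fM ys))// ler_norm.
    - apply: integrableZl => //; apply/integrableP; split.
        exact/measurable_EFinP.
      under eq_integral do rewrite gee0_abs ?lee_fin 1?ltW//.
      by rewrite Qh// ltry.
  congr fine; rewrite (integral_density (f := fun ys => h ys / h xs) (m := Q t xs)
      (mu := K t xs)).
  - by apply: eq_integral => ys _; rewrite -EFinM mulrA [_^-1 * _]mulrC.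
  - by move=> ys; rewrite divr_ge0// ltW.
  - exact: measurable_funM.
  - exact: KE.
  - exact/measurable_EFinP.
split; [by []|by exists K|].
move=> f bf t t0 xs.
have bLf := bounded_measurable_pker L bf.
have linkLf : link_op lam f = fun ys => \int[L ys]_x f x.
  by apply/funext => ys; apply: linkE; case: bf.
rewrite linkE; last by case: (bounded_measurable_pker (P t) bf).
rewrite linkLf QsE// /kernel_op.
apply: pker_commute_bounded => // g ys g0 mg.
have mPg : measurable_fun [set: Rn] (fun x => \int[P t x]_y g y)%E.
  by apply: measurable_fun_integral_kernel => //; exact: measurable_kernel.
have LgE zs (g' : Rn -> \bar R) : measurable_fun setT g' ->
    (\int[L zs]_x g' x = \int[m]_x ((lam zs x)%:E * g' x))%E.
  by move=> mg'; apply: integral_density => //; exact: LE.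
rewrite LgE// lamE//; last by move=> x; exact: integral_ge0.
rewrite -transfer//.
rewrite (integral_density (f := fun zs => h zs / h ys) (m := Q t ys)
  (mu := K t ys))//; last 4 first.
- by move=> zs; rewrite divr_ge0// ltW.
- exact: measurable_funM.
- exact: KE.
- by apply: measurable_fun_integral_kernel => //; exact: measurable_kernel.
have mI : measurable_fun [set: borel Dstar]
    (fun zs => \int[m]_x ((nu gamma x)%:E * ((Gam zs x)%:E * g x)))%E.
  apply: (measurable_fun_fubini_tonelli_F (m2 := m)
    (fun z => (nu gamma z.2)%:E * ((Gam z.1 z.2)%:E * g z.2))%E) => [|z]; last first.
    by rewrite !mule_ge0// lee_fin.
  apply: emeasurable_funM.
    by apply/measurable_EFinP; apply: (measurableT_comp mnu).
  apply: emeasurable_funM; first exact/measurable_EFinP.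
  by apply: (measurableT_comp mg).
rewrite -ge0_integralZl//; last 2 first.
- by move=> zs _; apply: integral_ge0 => x _; rewrite !mule_ge0 ?lee_fin.
- by rewrite lee_fin invr_ge0 ltW.
apply: eq_integral => zs _; rewrite LgE// lamE// muleA -EFinM.
by congr (_%:E * _)%E; rewrite mulrAC divff ?mul1r// gt_eqF.
Qed.
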